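(* Let $\alpha>0$, $n\in\mathbb N$, $0<a<b$ and let $x:[a,b]\to\mathbb R$ be a function of class $C^{n+1}$. Then, for $t\in[a,b)$, \[ {_t\mathcal{I}_b^\alpha} x(t)=\sum_{i=0}^{n}A_i(\alpha)\left(\ln\frac{b}{t}\right)^{\alpha+i} x_{i,0}(t)+\sum_{p=n+1}^\infty B(\alpha,p)\left(\ln\frac{b}{t}\right)^{\alpha+n-p}W_p(t), \] with \[ A_i(\alpha)=\frac{(-1)^i}{\Gamma(\alpha+i+1)}\left[1+\sum_{p=n-i+1}^\infty\frac{\Gamma(p-\alpha-n)}{\Gamma(-\alpha-i)(p-n+i)!}\right],\qquad B(\alpha,p)=\frac{\Gamma(p-\alpha-n)}{\Gamma(\alpha)\Gamma(1-\alpha)(p-n)!}, \] \[ W_p(t)=\int_t^b (p-n)\left(\ln\frac{b}{\tau}\right)^{p-n-1}\frac{x(\tau)}{\tau}\,d\tau. \]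
   Context: For $0<a<b$ and $\alpha>0$ the right Hadamard fractional integral is ${_t\mathcal{I}_b^\alpha} x(t)=\frac{1}{\Gamma(\alpha)}\int_t^b \left(\ln\frac{\tau}{t}\right)^{\alpha-1}\frac{x(\tau)}{\tau}\,d\tau$. The functions $x_{k,0}$ are defined recursively by $x_{0,0}(t)=x(t)$ and $x_{k+1,0}(t)=t\frac{d}{dt}x_{k,0}(t)$ for $k\ge 0$. $\Gamma$ is Euler's gamma function.
   Formalization: α is assumed not to be an integer, since for positive integer α the values Γ(1-α) and Γ(-α-i) are poles and the coefficients are undefined; x is taken as a function on ℝ with two-sided derivatives on [a,b], to which any C^{n+1} function on [a,b] extends. *)

(* Defs.v *)
From Stdlib Require Import Reals Factorial.
From Coquelicot Require Import Coquelicot.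
Open Scope R_scope.

Definition Gamma_pos (s : R) : R :=
  RInt_gen (fun u => Rpower u (s - 1) * exp (- u)) (at_right 0) (Rbar_locally p_infty).

Fixpoint rising (s : R) (k : nat) : R :=
  match k with O => 1 | S k' => rising s k' * (s + INR k') end.

(* Gamma on all of R minus the poles, by the functional equation
   Gamma s = Gamma (s+k) / (s (s+1) ... (s+k-1)) with k such that s+k > 0.
   (At the poles 0,-1,-2,... the value is meaningless; it is never used there.) *)
Definition Gamma (s : R) : R :=
  let k := Z.to_nat (up (- s)) in Gamma_pos (s + INR k) / rising s k.

Fixpoint xk0 (x : R -> R) (k : nat) : R -> R :=
  match k with
  | O => x
  | S k' => fun t => t * Derive (xk0 x k') t
  end.

(* x is of class C^k on [a,b] (derivatives taken in R) *)
Definition C_k_on (k : nat) (x : R -> R) (a b : R) : Prop :=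
  forall m : nat, (m <= k)%nat -> forall t, a <= t <= b ->
    continuous (Derive_n x m) t /\ ((m < k)%nat -> ex_derive (Derive_n x m) t).

Definition hadamard_kernel (alpha : R) (x : R -> R) (t : R) : R -> R :=
  fun tau => Rpower (ln (tau / t)) (alpha - 1) * x tau / tau.

Definition hadamard_right (alpha b : R) (x : R -> R) (t : R) : R :=
  / Gamma alpha * RInt_gen (hadamard_kernel alpha x t) (at_right t) (at_point b).

Definition A_term (alpha : R) (n i p : nat) : R :=
  Gamma (INR p - alpha - INR n) / (Gamma (- alpha - INR i) * INR (fact (p + i - n))).

Definition A_coef (alpha : R) (n i : nat) : R :=
  (-1) ^ i / Gamma (alpha + INR i + 1) *
  (1 + Series (fun q => A_term alpha n i (q + (n - i + 1))%nat)).

Definition B_coef (alpha : R) (n p : nat) : R :=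
  Gamma (INR p - alpha - INR n) / (Gamma alpha * Gamma (1 - alpha) * INR (fact (p - n))).

Definition W (x : R -> R) (n : nat) (b : R) (p : nat) (t : R) : R :=
  RInt (fun tau => INR (p - n) * (ln (b / tau)) ^ (p - n - 1) * x tau / tau) t b.

(* Main.v *)
(* With L = ln(b/t) and v = ln(b/tau) the kernel is (L-v)^(alpha-1), and the series in p is the
   binomial expansion of the kernel in powers of v/L, integrated term by term against x. The
   bracket in A_i is the binomial series of (1-z)^(alpha+i) at z = 1, so every A_i vanishes and
   only this expansion has to be justified, for which continuity of x suffices.
   Let c_q be the coefficients of (1-z)^(alpha-1), P_N the partial sums and R_N the remainder.
   The derivative of 1 - (1-z)^(1-alpha) P_N(z) is (N+1) c_(N+1) z^N (1-z)^(-alpha), so R_N has the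
   sign of c_(N+1) on [0,1); hence the integral of |R_N| over [0,1) is |c_(N+1)|/alpha, which
   tends to 0. This bounds the truncation error uniformly in the lower limit of integration, so
   that limit and the limit in N can be exchanged. *)
Require Import Defs.
From Stdlib Require Import Reals ZArith Factorial Lra Lia.
From Coquelicot Require Import Coquelicot.
Open Scope R_scope.

(** * Binomial coefficients of (1-z)^(-s) *)

(* Coefficient of [z^k] in [(1-z)^(-s)]. *)
Definition negbin (s : R) (k : nat) : R := rising s k / INR (fact k).

Lemma rising_Sl (s : R) (k : nat) : rising s (S k) = s * rising (s + 1) k.
Proof.
  induction k as [|k IH].
  - simpl; ring.
  - change (rising s (S (S k))) with (rising s (S k) * (s + INR (S k))).
    change (rising (s + 1) (S k)) with (rising (s + 1) k * (s + 1 + INR k)).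
    rewrite IH, S_INR; ring.
Qed.

Lemma negbin_0 (s : R) : negbin s 0 = 1.
Proof. unfold negbin; simpl; field. Qed.

Lemma negbin_S (s : R) (k : nat) :
  negbin s (S k) = negbin s k * (s + INR k) / INR (S k).
Proof.
  unfold negbin.
  change (rising s (S k)) with (rising s k * (s + INR k)).
  rewrite fact_simpl, mult_INR.
  field; split; [apply INR_fact_neq_0 | apply not_0_INR; lia].
Qed.

(** Coefficient form of the derivative rule ((1-z)^(-s))' = s (1-z)^(-(s+1)). *)
Lemma negbin_Sl (s : R) (k : nat) :
  negbin s (S k) = s * negbin (s + 1) k / INR (S k).
Proof.
  unfold negbin; rewrite rising_Sl, fact_simpl, mult_INR.
  field; split; [apply INR_fact_neq_0 | apply not_0_INR; lia].
Qed.

(** Dividing a generating function by 1-z replaces its coefficients by their partial sums, and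
    (1-z)^(-s) / (1-z) = (1-z)^(-(s+1)). *)
Lemma sum_negbin (s : R) (N : nat) :
  sum_f_R0 (negbin s) N = negbin (s + 1) N.
Proof.
  induction N as [|N IH]; [now simpl; rewrite !negbin_0|].
  rewrite tech5, IH, negbin_Sl, negbin_S, S_INR.
  field; pose proof (pos_INR N); lra.
Qed.

Lemma rising_neq_0 (s : R) (k : nat) :
  (forall z : Z, s <> IZR z) -> rising s k <> 0.
Proof.
  intros Hs; induction k as [|k IH]; [apply R1_neq_R0|].
  apply Rmult_integral_contrapositive; split; [exact IH|].
  intros H; apply (Hs (- Z.of_nat k)%Z).
  rewrite opp_IZR, <- INR_IZR_INZ; lra.
Qed.

Lemma negbin_neq_0 (s : R) (k : nat) :
  (forall z : Z, s <> IZR z) -> negbin s k <> 0.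
Proof.
  intros Hs; apply Rmult_integral_contrapositive; split.
  - now apply rising_neq_0.
  - apply Rinv_neq_0_compat, INR_fact_neq_0.
Qed.

(** * Exponential and logarithm bounds; decay of the binomial coefficients *)

Lemma exp_le (u v : R) : u <= v -> exp u <= exp v.
Proof.
  intros [H| ->]; [now apply Rlt_le, exp_increasing|apply Rle_refl].
Qed.

Lemma ln_le_sub1 (u : R) : 0 < u -> ln u <= u - 1.
Proof.
  intros Hu; destruct (Req_dec (ln u) 0) as [H|H].
  - rewrite H; apply Rnot_lt_le; intros H1.
    pose proof (ln_increasing u 1 Hu ltac:(lra)); rewrite ln_1 in *; lra.
  - pose proof (exp_ineq1 _ H); rewrite exp_ln in * by lra; lra.
Qed.

(* [1 - beta/(N+1) <= ((N+1)/(N+2))^beta], so [|negbin (1-beta) N| (N+1)^beta] eventually decreases. *)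
Lemma negbin_lim (beta : R) :
  0 < beta -> is_lim_seq (negbin (1 - beta)) 0.
Proof.
  intros Hb.
  (* From [N0] on, beta < N+1, so the ratio 1 - beta/(N+1) of consecutive coefficients is
     positive. *)
  destruct (nfloor_ex beta ltac:(lra)) as [N0 [_ HN0]].
  set (h N := Rabs (negbin (1 - beta) N) * Rpower (INR (S N)) beta).
  assert (Hstep : forall N, (N0 <= N)%nat -> h (S N) <= h N).
  { intros N HN; unfold h.
    apply le_INR in HN.
    rewrite (S_INR (S N)).
    assert (HN1 : beta < INR (S N)) by (rewrite S_INR; lra).
    set (m := INR (S N)) in *.
    rewrite negbin_S; unfold Rdiv; rewrite Rmult_assoc, Rabs_mult, Rmult_assoc.
    apply Rmult_le_compat_l; [apply Rabs_pos|].
    replace ((1 - beta + INR N) * / INR (S N)) with (1 - beta / m)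
      by (unfold m; rewrite S_INR; field; pose proof (pos_INR N); lra).
    assert (beta / m < 1) by (rewrite <- Rdiv_lt_1; lra).
    rewrite Rabs_pos_eq by lra.
    unfold Rpower.
    (* First 1 - beta/m <= exp(-beta/m), then ln(m+1) <= ln m + 1/m in the exponent. *)
    apply Rle_trans with (exp (- (beta / m)) * exp (beta * ln (m + 1))).
    { apply Rmult_le_compat_r; [apply Rlt_le, exp_pos|].
      pose proof (exp_ineq1_le (- (beta / m))); lra. }
    rewrite <- exp_plus; apply exp_le.
    assert (H1 : ln (m + 1) <= ln m + 1 / m).
    { replace (m + 1) with (m * ((m + 1) / m)) by (field; lra).
      rewrite ln_mult by (try apply Rdiv_lt_0_compat; lra).
      pose proof (ln_le_sub1 ((m + 1) / m) ltac:(apply Rdiv_lt_0_compat; lra)) as H1.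
      replace ((m + 1) / m - 1) with (1 / m) in H1 by (field; lra); lra. }
    apply Rmult_le_compat_l with (r := beta) in H1; [|lra].
    replace (beta * (ln m + 1 / m)) with (beta * ln m + beta / m) in H1 by (field; lra).
    lra. }
  assert (Hh : forall k, h (k + N0)%nat <= h N0).
  { induction k as [|k IH]; [apply Rle_refl|].
    apply Rle_trans with (2 := IH); apply (Hstep (k + N0)%nat); lia. }
  apply is_lim_seq_incr_n with N0.
  apply is_lim_seq_abs_0.
  apply is_lim_seq_le_le with (fun _ => 0)
    (fun k => h N0 * / Rpower (INR (S (k + N0))) beta).
  - intros k; split; [apply Rabs_pos|].
    specialize (Hh k); unfold h in Hh at 1.
    apply Rmult_le_reg_r with (Rpower (INR (S (k + N0))) beta); [apply exp_pos|].
    rewrite Rmult_assoc, Rinv_l, Rmult_1_r; [exact Hh|].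
    apply Rgt_not_eq, exp_pos.
  - apply is_lim_seq_const.
  - replace (Finite 0) with (Rbar_mult (h N0) 0) by (simpl; f_equal; ring).
    apply is_lim_seq_scal_l.
    replace (Finite 0) with (Rbar_inv p_infty) by reflexivity.
    apply is_lim_seq_inv; [|discriminate].
    unfold Rpower.
    apply (is_lim_comp_seq exp (fun k => beta * ln (INR (S (k + N0)))) p_infty p_infty).
    + apply is_lim_exp_p.
    + now exists 0%nat.
    + replace p_infty with (Rbar_mult beta p_infty).
      2:{ simpl; destruct (Rle_dec 0 beta) as [H|H]; [|lra].
          destruct (Rle_lt_or_eq_dec 0 beta H); [reflexivity|lra]. }
      apply is_lim_seq_scal_l.
      apply (is_lim_comp_seq ln (fun k => INR (S (k + N0))) p_infty p_infty).
      * apply is_lim_ln_p.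
      * now exists 0%nat.
      * apply is_lim_seq_ext with (fun k => INR (k + S N0)).
        { intros k; f_equal; lia. }
        apply is_lim_seq_incr_n with (u := INR), is_lim_seq_INR.
Qed.

(** * Truncated binomial series and the sign of the remainder *)

Definition bin_poly (s : R) (N : nat) (z : R) : R :=
  sum_f_R0 (fun q => negbin s q * z ^ q) N.

Definition bin_rem (s : R) (N : nat) (z : R) : R := Rpower (1 - z) (- s) - bin_poly s N z.

(** (1-z)^(-s) solves (1-z) y' = s y. For the truncation the recursion (k+1) c_(k+1) = (s+k) c_k
    cancels every coefficient of the defect except that of z^N. *)
Lemma is_derive_bin_poly (s : R) (N : nat) (z : R) :
  z < 1 ->
  is_derive (bin_poly s N) z
    ((s * bin_poly s N z - INR (S N) * negbin s (S N) * z ^ N) / (1 - z)).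
Proof.
  intros Hz; induction N as [|N IH].
  - unfold bin_poly; simpl sum_f_R0.
    rewrite negbin_S, negbin_0; simpl.
    auto_derive; [exact I|field; lra].
  - apply is_derive_ext with (fun z => bin_poly s N z + negbin s (S N) * z ^ S N).
    { intros u; reflexivity. }
    evar_last.
    { apply @is_derive_plus; [exact IH|].
      apply is_derive_scal with (f := fun z => z ^ S N).
      apply is_derive_pow, is_derive_id. }
    change (bin_poly s (S N) z) with (bin_poly s N z + negbin s (S N) * z ^ S N).
    rewrite (negbin_S s (S N)).
    change plus with Rplus; change one with 1; unfold scal; simpl Nat.pred.
    rewrite <- tech_pow_Rmult. simpl scal.
    rewrite !(S_INR (S N)).
    field; pose proof (pos_INR (S N)); lra.
Qed.

(* The derivative of [1 - (1-z)^s bin_poly s N z] is [(N+1) negbin s (N+1) z^N (1-z)^(s-1)]. *)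
Lemma bin_rem_sign (s : R) (N : nat) (z : R) :
  0 <= z < 1 -> 0 <= negbin s (S N) * bin_rem s N z.
Proof.
  intros Hz.
  set (c := negbin s (S N)).
  (* The extra factor [c] puts c^2 into the derivative, so both signs of [c] are treated at once. *)
  set (f := fun z => c * (1 - exp (s * ln (1 - z)) * bin_poly s N z)).
  assert (Hf : forall u, u < 1 -> is_derive f u
     (c * (c * (INR (S N) * u ^ N * exp (s * ln (1 - u)) / (1 - u))))).
  { intros u Hu; unfold f.
    pose proof (is_derive_bin_poly s N u Hu) as Hd.
    assert (He : ex_derive (bin_poly s N) u) by (eexists; exact Hd).
    auto_derive; [repeat split; auto; lra|].
    change (fun x => bin_poly s N x) with (bin_poly s N).
    rewrite (is_derive_unique _ _ _ Hd); fold c; unfold Rminus.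
    field; lra. }
  destruct (MVT_gen f 0 z (fun u => c * (c * (INR (S N) * u ^ N * exp (s * ln (1 - u)) / (1 - u)))))
    as [u [Hu Heq]].
  - intros u Hu; apply Hf; rewrite Rmax_right in Hu by lra; lra.
  - intros u Hu; apply continuity_pt_filterlim.
    apply (ex_derive_continuous f); eexists; apply Hf; rewrite Rmax_right in Hu by lra; lra.
  - rewrite Rmin_left, Rmax_right in Hu by lra.
    assert (Hf0 : f 0 = 0).
    { assert (Hp : forall K, bin_poly s K 0 = 1).
      { induction K as [|K IH]; unfold bin_poly in *; simpl in *.
        - rewrite negbin_0; ring.
        - rewrite IH; ring. }
      unfold f; rewrite Hp, Rminus_0_r, ln_1, Rmult_0_r, exp_0; ring. }
    assert (Hfz : 0 <= f z).
    { rewrite Hf0, !Rminus_0_r in Heq; rewrite Heq.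
      apply Rmult_le_pos; [|lra].
      rewrite <- Rmult_assoc; apply Rmult_le_pos; [apply Rle_0_sqr|].
      apply Rmult_le_pos; [|apply Rlt_le, Rinv_0_lt_compat; lra].
      apply Rmult_le_pos; [|apply Rlt_le, exp_pos].
      apply Rmult_le_pos; [apply pos_INR|apply pow_le; lra]. }
    (* Multiplying by (1-z)^(-s) > 0 turns [f] into [c] times the remainder. *)
    replace (c * bin_rem s N z) with (exp (- s * ln (1 - z)) * f z).
    { apply Rmult_le_pos; [apply Rlt_le, exp_pos|exact Hfz]. }
    unfold f, bin_rem, Rpower.
    replace (bin_poly s N z) with (exp (- s * ln (1 - z)) * exp (s * ln (1 - z)) * bin_poly s N z) at 2.
    { ring. }
    rewrite <- exp_plus.
    replace (- s * ln (1 - z) + s * ln (1 - z)) with 0 by ring.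
    rewrite exp_0; ring.
Qed.

(** * Convergence and functional equation of Euler's gamma integral *)

(** For a positive integrand the integral over [e,m] grows with the interval, so the improper
    integral is the supremum of these values. *)
Lemma is_RInt_gen_pos_bounded (f : R -> R) (K : R) :
  (forall u, 0 < u -> continuous f u) ->
  (forall u, 0 < u -> 0 < f u) ->
  (forall e m, 0 < e -> e <= m -> RInt f e m <= K) ->
  exists l, 0 < l /\ is_RInt_gen f (at_right 0) (Rbar_locally p_infty) l.
Proof.
  intros Hc Hp HK.
  assert (Hex : forall e m, 0 < e -> 0 < m -> ex_RInt f e m).
  { intros e m He Hm; apply (ex_RInt_continuous (V := R_CompleteNormedModule)).
    intros z [Hz _]; apply Hc.
    apply Rlt_le_trans with (2 := Hz); now apply Rmin_glb_lt. }
  set (E y := exists e m, 0 < e /\ e <= m /\ y = RInt f e m).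
  destruct (completeness E) as [l [Hub Hlub]].
  - exists K; intros y (e & m & He & Hm & ->); now apply HK.
  - exists (RInt f 1 1), 1, 1; repeat split; lra.
  - exists l; split.
    + apply Rlt_le_trans with (RInt f 1 2).
      * apply RInt_gt_0; [lra| |]; intros u Hu; [apply Hp|apply Hc]; lra.
      * apply Hub; exists 1, 2; repeat split; lra.
    + intros P [d Hd].
      assert (Hlt : exists e0 m0, 0 < e0 /\ e0 <= m0 /\ l - d < RInt f e0 m0).
      { apply Classical_Prop.NNPP; intros H.
        assert (l <= l - d); [|pose proof (cond_pos d); lra].
        apply Hlub; intros y (e & m & He & Hm & ->).
        apply Rnot_lt_le; intros H'; apply H; now exists e, m. }
      destruct Hlt as (e0 & m0 & He0 & Hm0 & Hl).
      (* Enlarging [e0,m0] keeps the integral between its value there, which exceeds l-d, and l. *)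
      apply Filter_prod with (fun e => 0 < e < e0) (fun m => m0 < m).
      * exists (mkposreal e0 He0); intros u Hu Hu0; split; [exact Hu0|].
        change (Rabs (u - 0) < e0) in Hu; rewrite Rminus_0_r in Hu.
        rewrite Rabs_pos_eq in Hu; lra.
      * now exists m0.
      * intros e m He Hm; exists (RInt f e m); simpl; split.
        { apply (RInt_correct (V := R_CompleteNormedModule)), Hex; lra. }
        apply Hd.
        assert (H1 : RInt f e m <= l) by (apply Hub; exists e, m; repeat split; lra).
        assert (H2 : RInt f e0 m0 <= RInt f e m).
        { rewrite <- (RInt_Chasles f e e0 m), <- (RInt_Chasles f e0 m0 m) by (apply Hex; lra).
          change plus with Rplus.
          assert (0 <= RInt f e e0).
          { apply RInt_ge_0; [lra|apply Hex; lra|].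
            intros u Hu; apply Rlt_le, Hp; lra. }
          assert (0 <= RInt f m0 m).
          { apply RInt_ge_0; [lra|apply Hex; lra|].
            intros u Hu; apply Rlt_le, Hp; lra. }
          lra. }
        change (Rabs (RInt f e m - l) < d).
        apply Rabs_def1; pose proof (cond_pos d); lra.
Qed.

(** The limit must be one-sided and punctured: since [ln] is 0 at 0 by convention, [Rpower 0 s] is
    1. *)
Lemma is_lim_Rpower_at_right_0 (s : R) :
  0 < s -> filterlim (fun u => Rpower u s) (at_right 0) (locally 0).
Proof.
  intros Hs P [d Hd].
  exists (mkposreal (Rpower d (/ s)) (exp_pos _)).
  intros u Hu Hu0; apply Hd.
  change (Rabs (u - 0) < Rpower d (/ s)) in Hu.
  rewrite Rminus_0_r, Rabs_pos_eq in Hu by lra.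
  change (Rabs (Rpower u s - 0) < d).
  rewrite Rminus_0_r, Rabs_pos_eq by apply Rlt_le, exp_pos.
  replace (pos d) with (Rpower (Rpower d (/ s)) s).
  - apply Rlt_Rpower_l; lra.
  - rewrite Rpower_mult, Rinv_l, Rpower_1 by (try apply cond_pos; lra); reflexivity.
Qed.

(** The maximum of u^s e^(-u) is s^s e^(-s), at u = s; the factor e^(-s) <= 1 is dropped. *)
Lemma Rpower_exp_le (s u : R) :
  0 < s -> 0 < u -> Rpower u s * exp (- u) <= Rpower s s.
Proof.
  intros Hs Hu; unfold Rpower; rewrite <- exp_plus; apply exp_le.
  pose proof (ln_le_sub1 (u / s) ltac:(apply Rdiv_lt_0_compat; lra)) as H.
  rewrite ln_div in H by lra.
  apply Rmult_le_compat_l with (r := s) in H; [|lra].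
  replace (s * (u / s - 1)) with (u - s) in H by (field; lra); lra.
Qed.

Definition gamma_integrand (s u : R) : R := Rpower u (s - 1) * exp (- u).

Lemma continuous_gamma_integrand (s u : R) :
  0 < u -> continuous (gamma_integrand s) u.
Proof.
  intros Hu; apply (ex_derive_continuous (gamma_integrand s)).
  unfold gamma_integrand, Rpower; auto_derive; exact Hu.
Qed.

(* [(u/(1+u))^s] is bounded, and its derivative [s u^(s-1) (1+u)^(-s-1)] dominates the integrand. *)
Lemma gamma_integrand_bound (s : R) :
  0 < s ->
  exists K, forall e m, 0 < e -> e <= m -> RInt (gamma_integrand s) e m <= K.
Proof.
  intros Hs.
  (* Chosen so that K s = e (s+1)^(s+1): since e^(-u) = e e^(-(1+u)) and (1+u)^(s+1) e^(-(1+u)) <=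
     (s+1)^(s+1), the integrand is at most K s u^(s-1) (1+u)^(-s-1). *)
  set (K := exp 1 * Rpower (s + 1) (s + 1) / s).
  assert (HK : 0 <= K).
  { apply Rlt_le, Rdiv_lt_0_compat; [|exact Hs].
    apply Rmult_lt_0_compat; apply exp_pos. }
  exists K; intros e m He Hm.
  set (h := fun u => K * exp (s * (ln u - ln (1 + u)))).
  set (dh := fun u => K * (s * (1 / u - 1 / (1 + u)) * exp (s * (ln u - ln (1 + u))))).
  assert (Hh : is_RInt dh e m (minus (h m) (h e))).
  { apply (is_RInt_derive (V := R_CompleteNormedModule) h dh);
      intros u Hu; rewrite Rmin_left in Hu by lra; unfold h, dh.
    - auto_derive; [lra|unfold Rminus; field; lra].
    - apply (ex_derive_continuous (fun u => K * (s * (1 / u - 1 / (1 + u)) * exp (s * (ln u - ln (1 + u)))))).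
      auto_derive; lra. }
  assert (Hf : is_RInt (gamma_integrand s) e m (RInt (gamma_integrand s) e m)).
  { apply (RInt_correct (V := R_CompleteNormedModule)).
    apply (ex_RInt_continuous (V := R_CompleteNormedModule)).
    intros u Hu; rewrite Rmin_left in Hu by lra.
    apply continuous_gamma_integrand; lra. }
  assert (H01 : forall u, 0 < u -> 0 <= h u <= K).
  { intros u Hu; unfold h; split.
    - apply Rmult_le_pos; [exact HK|apply Rlt_le, exp_pos].
    - rewrite <- (Rmult_1_r K) at 2; apply Rmult_le_compat_l; [exact HK|].
      apply Rle_trans with (exp 0); [apply exp_le|rewrite exp_0; lra].
      pose proof (ln_increasing u (1 + u) Hu ltac:(lra)); nra. }
  apply Rle_trans with (minus (h m) (h e)).
  - apply (is_RInt_le (gamma_integrand s) dh e m); auto.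
    intros u Hu; unfold gamma_integrand, dh, K.
    assert (Hu0 : 0 < u) by lra.
    pose proof (Rpower_exp_le (s + 1) (1 + u) ltac:(lra) ltac:(lra)) as H.
    set (C := Rpower (s + 1) (s + 1)) in *.
    replace (s * (1 / u - 1 / (1 + u)) * exp (s * (ln u - ln (1 + u))))
      with (s * (Rpower u (s - 1) * / Rpower (1 + u) (s + 1))).
    2:{ unfold Rpower.
        replace (s * (ln u - ln (1 + u)))
          with ((s - 1) * ln u + ln u + - ((s + 1) * ln (1 + u)) + ln (1 + u)) by ring.
        rewrite !exp_plus, exp_Ropp, !exp_ln by lra.
        field; repeat split; first [lra|apply Rgt_not_eq, exp_pos]. }
    replace (exp 1 * C / s * (s * (Rpower u (s - 1) * / Rpower (1 + u) (s + 1))))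
      with (Rpower u (s - 1) * (exp 1 * (C * / Rpower (1 + u) (s + 1)))) by (field; repeat split; first [lra|apply Rgt_not_eq, exp_pos]).
    apply Rmult_le_compat_l; [apply Rlt_le, exp_pos|].
    replace (- u) with (1 + - (1 + u)) by ring.
    rewrite exp_plus; apply Rmult_le_compat_l; [apply Rlt_le, exp_pos|].
    apply Rmult_le_reg_l with (Rpower (1 + u) (s + 1)); [apply exp_pos|].
    apply Rle_trans with (1 := H); right; field; apply Rgt_not_eq, exp_pos.
  - change (minus (h m) (h e)) with (h m - h e).
    pose proof (H01 m ltac:(lra)); pose proof (H01 e He); lra.
Qed.

Lemma Gamma_pos_correct (s : R) :
  0 < s ->
  0 < Gamma_pos s /\
  is_RInt_gen (gamma_integrand s) (at_right 0) (Rbar_locally p_infty) (Gamma_pos s).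
Proof.
  intros Hs.
  destruct (gamma_integrand_bound s Hs) as [K HK].
  destruct (is_RInt_gen_pos_bounded (gamma_integrand s) K) as [l [Hl Hi]]; auto.
  - apply continuous_gamma_integrand.
  - intros u _; apply Rmult_lt_0_compat; apply exp_pos.
  - change (Gamma_pos s) with
      (RInt_gen (gamma_integrand s) (at_right 0) (Rbar_locally p_infty)).
    now rewrite (is_RInt_gen_unique _ _ Hi).
Qed.

(** Integration by parts: F = -u^s e^(-u) vanishes at both ends, and F' is the integrand at s+1
    minus s times the integrand at s. *)
Lemma Gamma_pos_S (s : R) : 0 < s -> Gamma_pos (s + 1) = s * Gamma_pos s.
Proof.
  intros Hs.
  destruct (Gamma_pos_correct s Hs) as [_ Hi].
  set (F := fun u => - (exp (s * ln u) * exp (- u))).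
  assert (HF : forall u, 0 < u ->
    is_derive F u (gamma_integrand (s + 1) u - s * gamma_integrand s u)).
  { intros u Hu; unfold F, gamma_integrand, Rpower.
    auto_derive; [exact Hu|].
    replace (s + 1 - 1) with s by ring.
    replace ((s - 1) * ln u) with (s * ln u + - ln u) by ring.
    rewrite exp_plus, (exp_Ropp (ln u)), exp_ln by exact Hu; field; lra. }
  (* Both endpoints are eventually positive, so facts on (0,oo) hold on all the intervals of
     integration that matter. *)
  assert (Hpos : forall P : R -> Prop, (forall u, 0 < u -> P u) ->
    filter_prod (at_right 0) (Rbar_locally p_infty) (fun ab =>
      forall u, Rmin (fst ab) (snd ab) <= u <= Rmax (fst ab) (snd ab) -> P u)).
  { intros P HP; apply Filter_prod with (fun e => 0 < e) (fun m => 0 < m).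
    - exists (mkposreal 1 Rlt_0_1); auto.
    - now exists 0.
    - intros e m He Hm u [Hu _]; apply HP, Rlt_le_trans with (2 := Hu).
      now apply Rmin_glb_lt. }
  assert (HD : is_RInt_gen (Derive F) (at_right 0) (Rbar_locally p_infty) (0 - 0)).
  { apply is_RInt_gen_Derive.
    - apply Hpos; intros u Hu; eexists; apply HF, Hu.
    - apply Hpos; intros u Hu.
      apply continuous_ext_loc
        with (fun u => gamma_integrand (s + 1) u - s * gamma_integrand s u).
      + exists (mkposreal u Hu); intros v Hv.
        symmetry; apply is_derive_unique, HF.
        change (Rabs (v - u) < u) in Hv; apply Rabs_def2 in Hv; lra.
      + apply (continuous_minus (V := R_NormedModule)).
        * now apply continuous_gamma_integrand.
        * apply (continuous_scal_r (V := R_NormedModule)).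
          now apply continuous_gamma_integrand.
    - unfold F.
      replace 0 with (- (0 * exp (- 0))) at 2 by ring.
      apply (filterlim_comp _ _ _ (fun u => exp (s * ln u) * exp (- u)) Ropp _
               (locally (0 * exp (- 0)))).
      2: apply (filterlim_opp (V := R_NormedModule)).
      apply (filterlim_comp_2 (G := locally 0) (H := locally (exp (- 0)))).
      + now apply is_lim_Rpower_at_right_0.
      + apply (filterlim_filter_le_1 (F := locally 0)).
        * apply filter_le_within.
        * apply (ex_derive_continuous (fun u => exp (- u)) 0); auto_derive; exact I.
      + apply (filterlim_mult (K := R_AbsRing)).
    - change (is_lim F p_infty 0).
      (* [u^s e^(-u) = (u^(s+1) e^(-u)) / u <= C / u] *)
      apply is_lim_le_le_loc with (fun u => - (Rpower (s + 1) (s + 1) * / u)) (fun _ => 0).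
      + exists 0; intros u Hu; unfold F.
        pose proof (Rpower_exp_le (s + 1) u ltac:(lra) Hu) as H.
        split.
        * apply Ropp_le_contravar, Rmult_le_reg_r with u; [exact Hu|].
          replace (Rpower (s + 1) (s + 1) * / u * u) with (Rpower (s + 1) (s + 1)) by (field; lra).
          apply Rle_trans with (2 := H); right.
          rewrite Rpower_plus, (Rpower_1 u) by exact Hu; unfold Rpower; ring.
        * pose proof (exp_pos (s * ln u)); pose proof (exp_pos (- u)); nra.
      + replace (Finite 0) with (Rbar_opp (Rbar_mult (Rpower (s + 1) (s + 1)) (Rbar_inv p_infty)))
          by (simpl; f_equal; ring).
        apply is_lim_opp, is_lim_scal_l, is_lim_inv; [apply is_lim_id|discriminate].
      + apply is_lim_const. }
  change (Gamma_pos (s + 1)) with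
    (RInt_gen (gamma_integrand (s + 1)) (at_right 0) (Rbar_locally p_infty)).
  apply (is_RInt_gen_unique (V := R_CompleteNormedModule)).
  pose proof (is_RInt_gen_plus _ _ _ _ HD (is_RInt_gen_scal _ s _ Hi)) as H.
  replace (s * Gamma_pos s) with (plus (0 - 0) (scal s (Gamma_pos s)))
    by (unfold plus, scal; simpl; unfold mult; simpl; ring).
  revert H; apply is_RInt_gen_ext.
  destruct (Hpos _ HF) as [Q S HQ HS HQS].
  apply Filter_prod with Q S; auto.
  intros e m He Hm u Hu.
  rewrite (is_derive_unique _ _ _ (HQS e m He Hm u ltac:(simpl in *; lra))).
  unfold plus, scal; simpl; unfold mult; simpl; ring.
Qed.

(** * The extended gamma function away from the integers *)

(** The shift k satisfies s+k > 0, so the numerator is a convergent positive integral. *)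
Lemma Gamma_neq_0 (s : R) : (forall z : Z, s <> IZR z) -> Gamma s <> 0.
Proof.
  intros Hs; unfold Gamma.
  set (k := Z.to_nat (up (- s))).
  apply Rmult_integral_contrapositive; split.
  - apply Rgt_not_eq, Gamma_pos_correct.
    destruct (archimed (- s)) as [H _].
    unfold k; rewrite INR_IZR_INZ.
    destruct (Z.le_gt_cases 0 (up (- s))) as [H0|H0].
    + rewrite Z2Nat.id by lia; lra.
    + assert (H1 : IZR (up (- s)) < 0) by (apply IZR_lt; lia).
      pose proof (pos_INR (Z.to_nat (up (- s)))); rewrite INR_IZR_INZ in *; lra.
  - now apply Rinv_neq_0_compat, rising_neq_0.
Qed.

(** For s > 0 both shifts are 0 and the equation is that of the integral. For s < 0 the shift at s+1
    is one smaller, the numerators agree, and the rising products differ by the factor s. *)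
Lemma Gamma_S (s : R) : (forall z : Z, s <> IZR z) -> Gamma (s + 1) = s * Gamma s.
Proof.
  intros Hs; unfold Gamma.
  destruct (archimed (- s)) as [H1 H2].
  assert (Hup : up (- (s + 1)) = (up (- s) - 1)%Z).
  { symmetry; apply tech_up; rewrite minus_IZR; lra. }
  rewrite Hup.
  destruct (Rlt_or_le 0 s) as [H|H].
  - assert (Hz : (up (- s) <= 0)%Z).
    { apply Z.lt_succ_r, lt_IZR; rewrite succ_IZR; lra. }
    replace (Z.to_nat (up (- s))) with 0%nat by lia.
    replace (Z.to_nat (up (- s) - 1)) with 0%nat by lia.
    simpl; rewrite !Rplus_0_r, Gamma_pos_S by exact H; field.
  - assert (Hz : (0 < up (- s))%Z).
    { apply lt_IZR; specialize (Hs 0%Z); lra. }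
    replace (Z.to_nat (up (- s))) with (S (Z.to_nat (up (- s) - 1))) by lia.
    set (k := Z.to_nat (up (- s) - 1)).
    rewrite rising_Sl, S_INR.
    replace (s + (INR k + 1)) with (s + 1 + INR k) by ring.
    field; split; [apply rising_neq_0|exact (Hs 0%Z)].
    intros z Hz'; apply (Hs (z - 1)%Z); rewrite minus_IZR; lra.
Qed.

Lemma Gamma_shift (s : R) (k : nat) :
  (forall z : Z, s <> IZR z) -> Gamma (s + INR k) = rising s k * Gamma s.
Proof.
  intros Hs; induction k as [|k IH].
  - simpl; now rewrite Rplus_0_r, Rmult_1_l.
  - rewrite S_INR, <- Rplus_assoc, Gamma_S, IH; [simpl; ring|].
    intros z Hz; apply (Hs (z - Z.of_nat k)%Z).
    rewrite minus_IZR, <- INR_IZR_INZ; lra.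
Qed.

(** * Integral of the remainder *)

(** On z < 1 this is the primitive of [bin_rem (1 - alpha) N] that vanishes at 0. *)
Definition bin_rem_int (alpha : R) (N : nat) (z : R) : R :=
  (1 - Rpower (1 - z) alpha) / alpha
  - sum_f_R0 (fun q => negbin (1 - alpha) q * (z ^ S q / INR (S q))) N.

Lemma is_derive_bin_rem_int (alpha : R) (N : nat) (z : R) :
  0 < alpha -> z < 1 ->
  is_derive (bin_rem_int alpha N) z (bin_rem (1 - alpha) N z).
Proof.
  intros Ha Hz; unfold bin_rem_int, bin_rem.
  apply (is_derive_minus (V := R_NormedModule)).
  - unfold Rpower; auto_derive; [lra|].
    replace (- (1 - alpha) * ln (1 - z)) with (alpha * ln (1 + - z) + - ln (1 - z))
      by (unfold Rminus; ring).
    rewrite exp_plus, exp_Ropp, exp_ln by lra; field; lra.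
  - unfold bin_poly; induction N as [|N IH].
    + simpl; auto_derive; [exact I|field].
    + change (is_derive (fun z => sum_f_R0 (fun q => negbin (1 - alpha) q * (z ^ S q / INR (S q))) N
          + negbin (1 - alpha) (S N) * (z ^ S (S N) / INR (S (S N)))) z
        (sum_f_R0 (fun q => negbin (1 - alpha) q * z ^ q) N + negbin (1 - alpha) (S N) * z ^ S N)).
      apply (is_derive_plus (V := R_NormedModule)); [exact IH|].
      assert (HS : INR (S (S N)) <> 0) by (apply not_0_INR; lia).
      apply is_derive_scal.
      revert HS; generalize (S N) as k; intros k HS.
      auto_derive; [exact I|].
      simpl Nat.pred; field; exact HS.
Qed.

(** The sum telescopes, because c_q / (q+1) = (c_q - c_(q+1)) / alpha. *)
Lemma sum_negbin_div (alpha : R) (N : nat) :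
  0 < alpha ->
  sum_f_R0 (fun q => negbin (1 - alpha) q * (1 / INR (S q))) N
  = (1 - negbin (1 - alpha) (S N)) / alpha.
Proof.
  intros Ha; induction N as [|N IH].
  - simpl sum_f_R0; rewrite negbin_S, negbin_0; simpl; field; lra.
  - rewrite tech5, IH, (negbin_S _ (S N)), !S_INR.
    field; pose proof (pos_INR N); lra.
Qed.

(* With [c = negbin (1-alpha) (N+1)], [c * bin_rem_int] is nondecreasing on [0,1) with limit [c^2/alpha] at 1. *)
Lemma bin_rem_int_bound (alpha : R) (N : nat) (z : R) :
  0 < alpha -> 0 <= z < 1 ->
  negbin (1 - alpha) (S N) * bin_rem_int alpha N z <= (negbin (1 - alpha) (S N)) ^ 2 / alpha.
Proof.
  intros Ha Hz.
  set (c := negbin (1 - alpha) (S N)).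
  set (G := bin_rem_int alpha N).
  assert (Hmono : forall y, z < y < 1 -> c * G z <= c * G y).
  { intros y Hy.
    destruct (MVT_gen G z y (bin_rem (1 - alpha) N)) as [u [Hu Heq]];
      rewrite ?Rmin_left, ?Rmax_right in * by lra.
    - intros u Hu; apply is_derive_bin_rem_int; lra.
    - intros u Hu; apply continuity_pt_filterlim, (ex_derive_continuous G).
      eexists; apply is_derive_bin_rem_int; lra.
    - pose proof (bin_rem_sign (1 - alpha) N u ltac:(lra)) as H; fold c in H.
      assert (0 <= c * (G y - G z)); [|lra].
      rewrite Heq, <- Rmult_assoc; apply Rmult_le_pos; lra. }
  set (S1 := fun y => sum_f_R0 (fun q => negbin (1 - alpha) q * (y ^ S q / INR (S q))) N).
  assert (HS1 : continuous S1 1).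
  { apply (ex_derive_continuous S1); unfold S1.
    clear; induction N as [|N IH].
    - simpl; auto_derive; exact I.
    - apply (ex_derive_plus (V := R_NormedModule)); [exact IH|].
      auto_derive; exact I. }
  (* The 0 is the limit of (1-y)^alpha. Evaluating [G] at 1 would give another value, as
     [Rpower 0 alpha] is 1. *)
  assert (Hlim : filterlim (fun y => c * G y) (at_left 1) (locally (c * ((1 - 0) / alpha - S1 1)))).
  { replace (c * ((1 - 0) / alpha - S1 1))
      with (c * (1 / alpha - S1 1) + - (c / alpha) * 0) by (field; lra).
    apply filterlim_ext with
      (fun y => plus (c * (1 / alpha - S1 y)) (- (c / alpha) * Rpower (1 - y) alpha)).
    { intros y.
      change (c * (1 / alpha - S1 y) + - (c / alpha) * Rpower (1 - y) alpha = c * G y).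
      unfold G, bin_rem_int, S1; field; lra. }
    apply (filterlim_comp_2 (G := locally (c * (1 / alpha - S1 1)))
      (H := locally (- (c / alpha) * 0))).
    - apply (filterlim_filter_le_1 (F := locally 1)); [apply filter_le_within|].
      apply (continuous_scal_r (V := R_NormedModule) c (fun y => 1 / alpha - S1 y) 1).
      apply (continuous_minus (V := R_NormedModule)); [apply continuous_const|exact HS1].
    - apply (filterlim_comp _ _ _ (fun y => Rpower (1 - y) alpha)
        (fun u => - (c / alpha) * u) _ (locally 0)).
      + apply (filterlim_comp _ _ _ (fun y => 1 - y) (fun u => Rpower u alpha) _ (at_right 0)).
        * intros P [d Hd]; exists d; intros y Hy Hy1; apply Hd; [|lra].
          change (Rabs (y - 1) < d) in Hy; change (Rabs (1 - y - 0) < d).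
          rewrite Rabs_minus_sym in Hy; now rewrite Rminus_0_r.
        * now apply is_lim_Rpower_at_right_0.
      + apply (filterlim_scal_r (V := R_NormedModule)).
    - apply (filterlim_plus (V := R_NormedModule)). }
  replace (c ^ 2 / alpha) with (c * ((1 - 0) / alpha - S1 1)).
  2:{ unfold S1.
      rewrite (sum_eq _ (fun q => negbin (1 - alpha) q * (1 / INR (S q)))).
      2: now intros; rewrite pow1.
      rewrite sum_negbin_div by exact Ha; fold c; field; lra. }
  apply (filterlim_le (F := at_left 1) (fun _ => c * G z) (fun y => c * G y)
    (c * G z) (c * ((1 - 0) / alpha - S1 1))).
  - exists (mkposreal (1 - z) ltac:(lra)); intros y Hy Hy1; apply Hmono.
    change (Rabs (y - 1) < 1 - z) in Hy; apply Rabs_def2 in Hy; lra.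
  - apply filterlim_const.
  - exact Hlim.
Qed.

(** * Termwise integration of the expanded kernel *)

Lemma continuous_log_pow_div (b : R) (x : R -> R) (q : nat) (tau : R) :
  0 < b -> 0 < tau -> continuous x tau ->
  continuous (fun tau => ln (b / tau) ^ q * x tau / tau) tau.
Proof.
  intros Hb Htau Hx.
  apply continuous_ext with (fun tau => (ln (b / tau) ^ q / tau) * x tau).
  { intros u; refine (_ : _ = _ :> R); unfold Rdiv; ring. }
  apply (continuous_mult (K := R_AbsRing)); [|exact Hx].
  apply (ex_derive_continuous (fun tau => ln (b / tau) ^ q / tau)); auto_derive.
  repeat split; try lra; apply Rdiv_lt_0_compat; lra.
Qed.

Section Hadamard.
Variables (alpha t b M : R) (x : R -> R).
Hypothesis Halpha : 0 < alpha.
Hypothesis Hnonint : forall z : Z, alpha <> IZR z.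
Hypothesis Ht : 0 < t < b.
Hypothesis Hx : forall tau, t <= tau <= b -> continuous x tau.
Hypothesis HM : forall tau, t <= tau <= b -> Rabs (x tau) <= M.

Let L := ln (b / t).

(** Degree-q term in the expansion of (L-v)^(alpha-1) x(tau)/tau in powers of v = ln(b/tau). *)
Definition hadamard_term (q : nat) (tau : R) : R :=
  negbin (1 - alpha) q * Rpower L (alpha - 1 - INR q) * (ln (b / tau) ^ q * x tau / tau).

(** The binomial variable v/L: it is 0 at tau = b and 1 at tau = t, where the kernel may be
    singular. *)
Let zeta (tau : R) : R := ln (b / tau) / L.

Lemma log_ratio_pos : 0 < L.
Proof.
  unfold L; rewrite <- ln_1; apply ln_increasing; [lra|].
  apply Rmult_lt_reg_r with t; [lra|]; field_simplify; lra.
Qed.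

Lemma zeta_bounds (tau : R) : t < tau <= b -> 0 <= zeta tau < 1.
Proof.
  intros Htau; pose proof log_ratio_pos as HL; unfold zeta; split.
  - apply Rmult_le_pos; [|apply Rlt_le, Rinv_0_lt_compat, HL].
    rewrite <- ln_1; apply ln_le; [lra|].
    apply Rmult_le_reg_r with tau; [lra|]; field_simplify; lra.
  - rewrite <- Rdiv_lt_1 by exact HL; unfold L; rewrite !ln_div by lra.
    pose proof (ln_increasing t tau ltac:(lra) ltac:(lra)); lra.
Qed.

(** Since ln(tau/t) = L (1 - zeta), the kernel is L^(alpha-1) (1-zeta)^(alpha-1) x(tau)/tau. *)
Lemma kernel_remainder (N : nat) (tau : R) : t < tau <= b ->
  hadamard_kernel alpha x t tau - sum_f_R0 (fun q => hadamard_term q tau) N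
  = Rpower L (alpha - 1) * bin_rem (1 - alpha) N (zeta tau) * (x tau / tau).
Proof.
  intros Htau.
  pose proof log_ratio_pos as HL; pose proof (zeta_bounds tau Htau) as Hz.
  unfold hadamard_kernel, bin_rem.
  replace (ln (tau / t)) with (L * (1 - zeta tau)).
  2:{ unfold zeta, L in *; field_simplify; [|lra]; rewrite !ln_div by lra; ring. }
  rewrite <- Rpower_mult_distr by lra.
  replace (- (1 - alpha)) with (alpha - 1) by ring.
  assert (Hs : sum_f_R0 (fun q => hadamard_term q tau) N
    = Rpower L (alpha - 1) * bin_poly (1 - alpha) N (zeta tau) * (x tau / tau)).
  { rewrite Rmult_assoc, (Rmult_comm (bin_poly _ _ _)), <- Rmult_assoc.
    unfold bin_poly; rewrite scal_sum.
    apply sum_eq; intros q _; unfold hadamard_term, zeta, Rdiv.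
    replace (alpha - 1 - INR q) with (alpha - 1 + - INR q) by ring.
    rewrite Rpower_plus, Rpower_Ropp, Rpower_pow, Rpow_mult_distr, pow_inv by exact HL.
    ring. }
  rewrite Hs; unfold Rdiv; ring.
Qed.

Lemma continuous_hadamard_term (q : nat) (tau : R) :
  t <= tau <= b -> continuous (hadamard_term q) tau.
Proof.
  intros Htau; unfold hadamard_term.
  apply (continuous_scal_r (V := R_NormedModule)).
  apply continuous_log_pow_div; [lra|lra|now apply Hx].
Qed.

Lemma continuous_kernel (tau : R) :
  t < tau <= b -> continuous (hadamard_kernel alpha x t) tau.
Proof.
  intros Htau; unfold hadamard_kernel.
  apply continuous_ext with (fun tau => (Rpower (ln (tau / t)) (alpha - 1) / tau) * x tau).
  { intros u; refine (_ : _ = _ :> R); unfold Rdiv; ring. }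
  apply (continuous_mult (K := R_AbsRing)); [|apply Hx; lra].
  apply (ex_derive_continuous (fun tau => Rpower (ln (tau / t)) (alpha - 1) / tau)).
  unfold Rpower; auto_derive.
  assert (1 < tau * / t).
  { apply Rmult_lt_reg_r with t; [lra|]; field_simplify; lra. }
  repeat split; try lra.
  rewrite <- ln_1; apply ln_increasing; lra.
Qed.

Lemma ex_RInt_term (q : nat) (s : R) : t <= s <= b -> ex_RInt (hadamard_term q) s b.
Proof.
  intros Hs; apply (ex_RInt_continuous (V := R_CompleteNormedModule)).
  intros u Hu; rewrite Rmin_left, Rmax_right in Hu by lra.
  apply continuous_hadamard_term; lra.
Qed.

Lemma is_RInt_sum_term (N : nat) (s : R) : t <= s <= b ->
  is_RInt (fun tau => sum_f_R0 (fun q => hadamard_term q tau) N) s b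
    (sum_f_R0 (fun q => RInt (hadamard_term q) s b) N).
Proof.
  intros Hs; induction N as [|N IH]; simpl.
  - apply (RInt_correct (V := R_CompleteNormedModule)), ex_RInt_term, Hs.
  - apply (is_RInt_plus (V := R_NormedModule)); [exact IH|].
    apply (RInt_correct (V := R_CompleteNormedModule)), ex_RInt_term, Hs.
Qed.

(** Substitution z = zeta(tau), with dz = -dtau/(tau L); the upper limit tau = b contributes 0. *)
Lemma is_RInt_rem (N : nat) (s k : R) : t < s <= b ->
  is_RInt (fun tau => k * (bin_rem (1 - alpha) N (zeta tau) / tau)) s b
    (k * (L * bin_rem_int alpha N (zeta s))).
Proof.
  intros Hs; pose proof log_ratio_pos as HL.
  apply (is_RInt_scal (V := R_NormedModule) (fun tau => bin_rem (1 - alpha) N (zeta tau) / tau)).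
  set (F := fun tau => - (L * bin_rem_int alpha N (zeta tau))).
  replace (L * bin_rem_int alpha N (zeta s)) with (F b - F s).
  2:{ unfold F; unfold zeta at 1.
      replace (b / b) with 1 by (field; lra).
      rewrite ln_1; replace (0 / L) with 0 by (field; lra).
      replace (bin_rem_int alpha N 0) with 0; [refine (_ : _ = _ :> R); ring|].
      unfold bin_rem_int, Rpower; rewrite Rminus_0_r, ln_1, Rmult_0_r, exp_0.
      rewrite (sum_eq _ (fun _ => 0)), sum_cte; [field; lra|].
      intros i _; simpl pow; unfold Rdiv; ring. }
  apply (is_RInt_derive (V := R_CompleteNormedModule) F);
    intros u Hu; rewrite Rmin_left, Rmax_right in Hu by lra.
  - pose proof (is_derive_bin_rem_int alpha N (zeta u) Halpha
      (proj2 (zeta_bounds u ltac:(lra)))) as Hd.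
    unfold F.
    assert (Hz : is_derive zeta u (- / (u * L))).
    { unfold zeta; auto_derive.
      - repeat split; first [lra|apply Rdiv_lt_0_compat; lra].
      - field; lra. }
    pose proof (is_derive_comp _ _ _ _ _ Hd Hz) as Hc.
    apply (is_derive_scal _ _ L) in Hc.
    apply (is_derive_opp (V := R_NormedModule)) in Hc.
    evar_last; [exact Hc|].
    unfold opp, scal; simpl; unfold mult; simpl; field; lra.
  - apply (continuous_mult (K := R_AbsRing) (fun tau => bin_rem (1 - alpha) N (zeta tau)) Rinv).
    + apply (continuous_comp zeta (bin_rem (1 - alpha) N)).
      * apply (ex_derive_continuous zeta); unfold zeta; auto_derive.
        repeat split; first [lra|apply Rdiv_lt_0_compat; lra].
      * pose proof (zeta_bounds u ltac:(lra)) as Hz.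
        apply (ex_derive_continuous (bin_rem (1 - alpha) N)).
        apply (ex_derive_minus (V := R_NormedModule)).
        -- unfold Rpower; auto_derive; lra.
        -- eexists; apply is_derive_bin_poly; lra.
    + apply (ex_derive_continuous Rinv); auto_derive; lra.
Qed.

(** The constant sign of the remainder removes its absolute value, leaving a majorant with an
    explicit primitive. The bound is independent of [s]. *)
Lemma truncation_bound (N : nat) (s : R) : t < s <= b ->
  Rabs (RInt (hadamard_kernel alpha x t) s b - sum_f_R0 (fun q => RInt (hadamard_term q) s b) N)
  <= M * Rpower L (alpha - 1) * L / alpha * Rabs (negbin (1 - alpha) (S N)).
Proof.
  intros Hs; pose proof log_ratio_pos as HL.
  assert (HM0 : 0 <= M) by (apply Rle_trans with (2 := HM b ltac:(lra)), Rabs_pos).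
  set (c := negbin (1 - alpha) (S N)).
  (* Non-integrality of alpha makes [c] nonzero, so its sign can be written c/|c|. *)
  assert (Hc : 0 < Rabs c).
  { apply Rabs_pos_lt, negbin_neq_0; intros z Hz.
    apply (Hnonint (1 - z)%Z); rewrite minus_IZR; lra. }
  (* The sign in [k] makes [k] times the remainder equal to M L^(alpha-1) times its absolute
     value. *)
  set (k := M * Rpower L (alpha - 1) * (c / Rabs c)).
  apply Rle_trans with (k * (L * bin_rem_int alpha N (zeta s))).
  - apply (norm_RInt_le (V := R_NormedModule)
      (fun tau => hadamard_kernel alpha x t tau - sum_f_R0 (fun q => hadamard_term q tau) N)
      (fun tau => k * (bin_rem (1 - alpha) N (zeta tau) / tau)) s b); [lra| | |].
    + intros u Hu.
      change (Rabs (hadamard_kernel alpha x t u - sum_f_R0 (fun q => hadamard_term q u) N)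
        <= k * (bin_rem (1 - alpha) N (zeta u) / u)).
      rewrite kernel_remainder by lra.
      pose proof (bin_rem_sign (1 - alpha) N (zeta u) (zeta_bounds u ltac:(lra))) as Hr.
      fold c in Hr; set (r := bin_rem (1 - alpha) N (zeta u)) in *.
      assert (Hr' : Rabs r = c / Rabs c * r).
      { apply Rmult_eq_reg_l with (Rabs c); [|lra].
        rewrite <- Rabs_mult, Rabs_pos_eq by exact Hr; field; lra. }
      unfold Rdiv; rewrite !Rabs_mult, Hr', (Rabs_pos_eq (Rpower L (alpha - 1)))
        by apply Rlt_le, exp_pos.
      rewrite (Rabs_pos_eq (/ u)) by (apply Rlt_le, Rinv_0_lt_compat; lra).
      rewrite <- Hr'; unfold k.
      replace (M * Rpower L (alpha - 1) * (c / Rabs c) * (r * / u))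
        with (Rpower L (alpha - 1) * (c / Rabs c * r) * (M * / u)) by ring.
      rewrite <- Hr'.
      apply Rmult_le_compat_l.
      * apply Rmult_le_pos; [apply Rlt_le, exp_pos|apply Rabs_pos].
      * apply Rmult_le_compat_r; [apply Rlt_le, Rinv_0_lt_compat; lra|apply HM; lra].
    + apply (is_RInt_minus (V := R_NormedModule)).
      * apply (RInt_correct (V := R_CompleteNormedModule)).
        apply (ex_RInt_continuous (V := R_CompleteNormedModule)).
        intros u Hu; rewrite Rmin_left, Rmax_right in Hu by lra.
        apply continuous_kernel; lra.
      * apply is_RInt_sum_term; lra.
    + now apply is_RInt_rem.
  - pose proof (bin_rem_int_bound alpha N (zeta s) Halpha (zeta_bounds s Hs)) as HG.
    fold c in HG; rewrite <- pow2_abs in HG.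
    replace (k * (L * bin_rem_int alpha N (zeta s)))
      with (M * Rpower L (alpha - 1) * L * (/ Rabs c * (c * bin_rem_int alpha N (zeta s))))
      by (unfold k; field; lra).
    replace (M * Rpower L (alpha - 1) * L / alpha * Rabs c)
      with (M * Rpower L (alpha - 1) * L * (/ Rabs c * (Rabs c ^ 2 / alpha))) by (field; lra).
    apply Rmult_le_compat_l.
    + apply Rmult_le_pos; [apply Rmult_le_pos; [exact HM0|apply Rlt_le, exp_pos]|lra].
    + apply Rmult_le_compat_l; [apply Rlt_le, Rinv_0_lt_compat, Hc|exact HG].
Qed.

(** Exchanging s -> t+ with N -> oo also proves that the improper integral exists:
    [filterlim_switch] yields one limit for both sides. *)
Lemma hadamard_expansion : exists l,
  is_RInt_gen (hadamard_kernel alpha x t) (at_right t) (at_point b) l /\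
  is_series (fun q => RInt (hadamard_term q) t b) l.
Proof.
  (* Both sides are set to 0 off [(t,b]] so that [truncation_bound] is convergence in the sup norm. *)
  set (clip := fun (f : R -> R) s =>
    if Rlt_dec t s then if Rle_dec s b then f s else 0 else 0).
  set (C := M * Rpower L (alpha - 1) * L / alpha).
  destruct (filterlim_switch (T1 := nat) (T2 := R) (U := R_CompleteSpace)
    eventually _ (at_right t) _
    (fun N => clip (fun s => sum_f_R0 (fun q => RInt (hadamard_term q) s b) N))
    (clip (fun s => RInt (hadamard_kernel alpha x t) s b))
    (fun N => sum_f_R0 (fun q => RInt (hadamard_term q) t b) N)) as [l [Hl1 Hl2]].
  - intros P [d Hd].
    assert (Hc : is_lim_seq (fun N => C * Rabs (negbin (1 - alpha) (S N))) 0).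
    { replace (Finite 0) with (Rbar_mult C 0) by (simpl; f_equal; ring).
      apply is_lim_seq_scal_l, (is_lim_seq_incr_1 (fun N => Rabs (negbin (1 - alpha) N))).
      apply -> is_lim_seq_abs_0; now apply negbin_lim. }
    apply is_lim_seq_spec in Hc; destruct (Hc d) as [N0 HN0].
    exists N0; intros N HN; apply Hd; intros s.
    change (Rabs (clip (fun s => sum_f_R0 (fun q => RInt (hadamard_term q) s b) N) s
      - clip (fun s => RInt (hadamard_kernel alpha x t) s b) s) < d).
    unfold clip; destruct (Rlt_dec t s) as [H1|]; [destruct (Rle_dec s b) as [H2|]|];
      try (rewrite Rminus_0_r, Rabs_R0; apply cond_pos).
    rewrite Rabs_minus_sym.
    apply Rle_lt_trans with (1 := truncation_bound N s (conj H1 H2)).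
    specialize (HN0 N HN); rewrite Rminus_0_r in HN0.
    apply Rle_lt_trans with (2 := HN0), Rle_abs.
  - intros N.
    apply filterlim_ext_loc with (fun s => sum_f_R0 (fun q => RInt (hadamard_term q) s b) N).
    { exists (mkposreal (b - t) ltac:(lra)); intros s Hs H1.
      change (Rabs (s - t) < b - t) in Hs; apply Rabs_def2 in Hs.
      unfold clip; destruct (Rlt_dec t s); [destruct (Rle_dec s b)|]; lra. }
    assert (Hq : forall q, filterlim (fun s => RInt (hadamard_term q) s b) (at_right t)
                             (locally (RInt (hadamard_term q) t b))).
    { intros q P [d Hd].
      destruct (bounded_continuity (hadamard_term q) t b) as [K HK].
      { intros u Hu; now apply continuous_hadamard_term. }
      assert (HK0 : 0 < K) by (apply Rle_lt_trans with (2 := HK b ltac:(lra)), Rabs_pos).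
      (* The integral over [t,s] is at most (s-t) K in absolute value, hence the radius d/K. *)
      assert (He : 0 < Rmin (b - t) (d / K)).
      { apply Rmin_pos; [lra|apply Rdiv_lt_0_compat; [apply cond_pos|exact HK0]]. }
      exists (mkposreal _ He); intros s Hs H1; apply Hd.
      change (Rabs (s - t) < Rmin (b - t) (d / K)) in Hs.
      rewrite Rabs_pos_eq in Hs by lra.
      pose proof (Rmin_l (b - t) (d / K)); pose proof (Rmin_r (b - t) (d / K)).
      change (Rabs (RInt (hadamard_term q) s b - RInt (hadamard_term q) t b) < d).
      assert (Hex : ex_RInt (hadamard_term q) t s).
      { apply (ex_RInt_Chasles_1 (V := R_CompleteNormedModule)) with b; [lra|apply ex_RInt_term; lra]. }
      rewrite <- (RInt_Chasles (hadamard_term q) t s b Hex) by (apply ex_RInt_term; lra).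
      change plus with Rplus.
      replace (RInt (hadamard_term q) s b - (RInt (hadamard_term q) t s + RInt (hadamard_term q) s b))
        with (- RInt (hadamard_term q) t s) by ring.
      rewrite Rabs_Ropp.
      apply Rle_lt_trans with ((s - t) * K).
      - apply abs_RInt_le_const; [lra|exact Hex|].
        intros u Hu; apply Rlt_le, (HK u); lra.
      - apply Rmult_lt_reg_r with (/ K); [now apply Rinv_0_lt_compat|].
        rewrite Rmult_assoc, Rinv_r by lra; unfold Rdiv in *; lra. }
    induction N as [|N IH]; [apply Hq|].
    apply (filterlim_comp_2 (G := locally (sum_f_R0 (fun q => RInt (hadamard_term q) t b) N))
      (H := locally (RInt (hadamard_term (S N)) t b)) _ _ Rplus); [exact IH|apply Hq|].
    apply (filterlim_plus (V := R_NormedModule)).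
  - exists l; split.
    + intros P HP; specialize (Hl2 P HP).
      apply Filter_prod with
        (fun s => (t < s < b) /\ P (RInt (hadamard_kernel alpha x t) s b)) (fun y => y = b).
      * destruct Hl2 as [d Hd].
        (* The radius b-t keeps [s] inside (t,b), where [clip] changes nothing. *)
        exists (mkposreal (Rmin d (b - t)) ltac:(apply Rmin_pos; [apply cond_pos|lra])).
        intros s Hs H1; change (Rabs (s - t) < Rmin d (b - t)) in Hs.
        assert (H2 : t < s < b).
        { pose proof (Rmin_r d (b - t)); apply Rabs_def2 in Hs; lra. }
        split; [exact H2|].
        specialize (Hd s (Rlt_le_trans _ _ _ Hs (Rmin_l _ _)) H1); unfold clip in Hd.
        destruct (Rlt_dec t s); [destruct (Rle_dec s b)|]; (exact Hd || lra).
      * reflexivity.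
      * intros s y [Hs HPs] ->; exists (RInt (hadamard_kernel alpha x t) s b); split; [|exact HPs].
        apply (RInt_correct (V := R_CompleteNormedModule)).
        apply (ex_RInt_continuous (V := R_CompleteNormedModule)).
        simpl; intros u Hu; rewrite Rmin_left, Rmax_right in Hu by lra.
        apply continuous_kernel; lra.
    + apply filterlim_ext with (2 := Hl1); intros N; symmetry; apply sum_n_Reals.
Qed.
End Hadamard.

(** * The coefficients A and B, and the theorem *)

(** The terms are the coefficients of (1-z)^(alpha+i) from degree 1 on. The full series is 0 at z =
    1 and its constant term is 1, which leaves -1. *)
Lemma is_series_A_term (alpha : R) (n i : nat) :
  0 < alpha -> (forall z : Z, alpha <> IZR z) -> (i <= n)%nat ->
  is_series (fun q => A_term alpha n i (q + (n - i + 1))%nat) (-1).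
Proof.
  intros Ha Hz Hi.
  set (s := - alpha - INR i).
  assert (Hs : forall z : Z, s <> IZR z).
  { intros z H; apply (Hz (- z - Z.of_nat i)%Z).
    rewrite minus_IZR, opp_IZR, <- INR_IZR_INZ; unfold s in H; lra. }
  apply is_series_ext with (fun q => negbin s (S q)).
  { intros q; unfold A_term, negbin.
    replace (q + (n - i + 1) + i - n)%nat with (S q) by lia.
    replace (INR (q + (n - i + 1)) - alpha - INR n) with (s + INR (S q)).
    2:{ unfold s; rewrite S_INR, !plus_INR, minus_INR by exact Hi; simpl; ring. }
    rewrite Gamma_shift by exact Hs; fold s.
    refine (_ : _ = _ :> R).
    field; split; [apply INR_fact_neq_0|now apply Gamma_neq_0]. }
  assert (Hl : is_series (negbin s) 0).
  { apply (filterlim_ext (negbin (s + 1))).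
    - intros N; rewrite <- sum_negbin; symmetry; apply sum_n_Reals.
    - replace (s + 1) with (1 - (alpha + INR i)) by (unfold s; ring).
      apply negbin_lim; pose proof (pos_INR i); lra. }
  apply (is_series_incr_1 (negbin s)).
  evar_last; [exact Hl|].
  change (0 = -1 + negbin s 0); rewrite negbin_0; ring.
Qed.

(** With p = q+n+1, Gamma(1-alpha+q) / Gamma(1-alpha) is a rising factorial, and the factor p-n =
    q+1 of W reduces (q+1)! in B to q!. *)
Lemma B_term_eq (alpha t b : R) (x : R -> R) (n q : nat) :
  (forall z : Z, alpha <> IZR z) -> 0 < t < b ->
  (forall tau, t <= tau <= b -> continuous x tau) ->
  B_coef alpha n (q + (n + 1)) * Rpower (ln (b / t)) (alpha + INR n - INR (q + (n + 1)))
    * W x n b (q + (n + 1)) t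
  = / Gamma alpha * RInt (hadamard_term alpha t b x q) t b.
Proof.
  intros Hz Ht Hx.
  assert (Hz' : forall z : Z, 1 - alpha <> IZR z).
  { intros z H; apply (Hz (1 - z)%Z); rewrite minus_IZR; lra. }
  unfold B_coef, W.
  replace (q + (n + 1) - n)%nat with (S q) by lia.
  replace (S q - 1)%nat with q by lia.
  replace (INR (q + (n + 1)) - alpha - INR n) with (1 - alpha + INR q)
    by (rewrite !plus_INR; simpl; ring).
  replace (alpha + INR n - INR (q + (n + 1))) with (alpha - 1 - INR q)
    by (rewrite !plus_INR; simpl; ring).
  rewrite Gamma_shift by exact Hz'.
  assert (Hex : ex_RInt (fun tau => ln (b / tau) ^ q * x tau / tau) t b).
  { apply (ex_RInt_continuous (V := R_CompleteNormedModule)).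
    intros u Hu; rewrite Rmin_left, Rmax_right in Hu by lra.
    apply continuous_log_pow_div; [lra|lra|now apply Hx]. }
  assert (Hscal : forall k, RInt (fun tau => k * (ln (b / tau) ^ q * x tau / tau)) t b
    = k * RInt (fun tau => ln (b / tau) ^ q * x tau / tau) t b).
  { intros k; now apply (RInt_scal (V := R_CompleteNormedModule)). }
  rewrite (RInt_ext _ (fun tau => INR (S q) * (ln (b / tau) ^ q * x tau / tau)))
    by (intros; refine (_ : _ = _ :> R); unfold Rdiv; ring).
  unfold hadamard_term; rewrite !Hscal; unfold negbin.
  rewrite fact_simpl, mult_INR.
  field; repeat split; auto using Gamma_neq_0, INR_fact_neq_0.
  apply not_0_INR; lia.
Qed.

Theorem theorem6p4 (alpha : R) (n : nat) (a b : R) (x : R -> R)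
  (Halpha : 0 < alpha)
  (Halpha_nonint : forall z : Z, alpha <> IZR z)
  (Ha : 0 < a) (Hab : a < b)
  (Hx : C_k_on (S n) x a b) :
  forall t : R, a <= t < b ->
    ex_RInt_gen (hadamard_kernel alpha x t) (at_right t) (at_point b) /\
    (forall i : nat, (i <= n)%nat ->
       ex_series (fun q => A_term alpha n i (q + (n - i + 1))%nat)) /\
    is_series
      (fun q => let p := (q + (n + 1))%nat in
         B_coef alpha n p * Rpower (ln (b / t)) (alpha + INR n - INR p) * W x n b p t)
      (hadamard_right alpha b x t
       - sum_f_R0 (fun i => A_coef alpha n i * Rpower (ln (b / t)) (alpha + INR i)
                            * xk0 x i t) n).
Proof.
  intros t Ht.
  assert (Hc : forall tau, t <= tau <= b -> continuous x tau).
  { intros tau Htau; apply (Hx 0%nat); [lia|lra]. }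
  destruct (bounded_continuity x t b Hc) as [M HM].
  assert (Ht0 : 0 < t < b) by lra.
  destruct (hadamard_expansion alpha t b M x Halpha Halpha_nonint Ht0 Hc) as [l [Hl Hs]].
  { intros tau Htau; apply Rlt_le, (HM tau Htau). }
  split; [now exists l|split].
  { intros i Hi; exists (-1); now apply is_series_A_term. }
  (* Each bracket in [A_coef] is 1 + (-1), so the finite sum vanishes and the p-series carries the
     whole integral. *)
  rewrite (sum_eq _ (fun _ => 0)), sum_cte, Rmult_0_l, Rminus_0_r.
  2:{ intros i Hi; unfold A_coef.
      rewrite (is_series_unique _ _ (is_series_A_term alpha n i Halpha Halpha_nonint Hi)); ring. }
  unfold hadamard_right; rewrite (is_RInt_gen_unique _ _ Hl).
  apply is_series_ext with (fun q => / Gamma alpha * RInt (hadamard_term alpha t b x q) t b).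
  { intros q; symmetry; now apply B_term_eq. }
  apply (is_series_scal (V := R_NormedModule) (/ Gamma alpha) _ _ Hs).
Qed.
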